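(* Let $\mathcal{S}=[s_0,\ldots,s_{k-1}]$ be a binary $(n,R)$-covering sequence of length $k$, and for an integer $j$ let $\mathbf{E}^j\mathcal{S}=[s_j,s_{j+1},\ldots,s_{k-1},s_0,\ldots,s_{j-1}]$ (indices mod $k$) denote its cyclic left shift by $j$. If $k$ is even, let $\mathcal{A}$ be the $(k+1)\times k$ array whose $i$-th row, $0\le i\le k-1$, is $\mathbf{E}^{i(i+1)/2}\mathcal{S}$ and whose $k$-th row equals its $(k-1)$-th row; then $\mathcal{A}$ is a $(2\times n,2R)$-covering 2D-sequence. If $k$ is odd, let $\mathcal{A}$ be the $k\times k$ array whose $i$-th row, $0\le i\le k-1$, is $\mathbf{E}^{i(i+1)/2}\mathcal{S}$; then $\mathcal{A}$ is a $(2\times n,2R)$-covering 2D-sequence.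
   Context: A cyclic binary sequence of length $k$ has as its windows of length $n$ the words $(s_i,\ldots,s_{i+n-1})$, $0\le i\le k-1$, indices modulo $k$; it is an $(n,R)$-covering sequence if every $x\in\{0,1\}^n$ is within Hamming distance $R$ of some window. An $M\times N$ binary array $A=(A_{r,c})$ is regarded as doubly periodic (a torus); its $m\times n$ windows are the arrays $(A_{(r+a)\bmod M,\,(c+b)\bmod N})_{0\le a<m,\,0\le b<n}$ for $0\le r<M$, $0\le c<N$. It is an $(m\times n,R)$-covering 2D-sequence if for every binary $m\times n$ matrix $B$ there is a window $X$ with $d(B,X)\le R$, where $d$ counts differing entries. *)

(* Defs.v *)
From mathcomp Require Import all_boot all_order all_algebra.

Set Implicit Arguments.
Unset Strict Implicit.
Unset Printing Implicit Defensive.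

(* The index [(i + a) mod k]; the given [i : 'I_k] witnesses [0 < k]. *)
Definition cyc_add k (i : 'I_k) (a : nat) : 'I_k :=
  Ordinal (ltn_pmod (i + a) (leq_ltn_trans (leq0n i) (ltn_ord i))).

Definition word_dist n (x y : n.-tuple bool) : nat :=
  #|[set i : 'I_n | tnth x i != tnth y i]|.

Definition mx_dist m n (B X : 'M[bool]_(m, n)) : nat :=
  #|[set p : 'I_m * 'I_n | B p.1 p.2 != X p.1 p.2]|.

Definition seq_window k (n : nat) (s : k.-tuple bool) (i : 'I_k)
    : n.-tuple bool :=
  [tuple tnth s (cyc_add i j) | j < n].

Definition covering_seq k (n R : nat) (s : k.-tuple bool) : Prop :=
  forall x : n.-tuple bool, exists i : 'I_k, word_dist x (seq_window n s i) <= R.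

Definition array_window M N (m n : nat) (A : 'M[bool]_(M, N))
    (r : 'I_M) (c : 'I_N) : 'M[bool]_(m, n) :=
  (\matrix_(a < m, b < n) A (cyc_add r a) (cyc_add c b))%R.

Definition covering_array M N (m n R : nat) (A : 'M[bool]_(M, N)) : Prop :=
  forall B : 'M[bool]_(m, n), exists (r : 'I_M) (c : 'I_N),
    mx_dist B (array_window m n A r c) <= R.

Definition cyc_shift k (j : nat) (s : k.-tuple bool) : k.-tuple bool :=
  [tuple tnth s (cyc_add i j) | i < k].

Definition triangular_row k (s : k.-tuple bool) (i : nat) : k.-tuple bool :=
  cyc_shift ((i * (i + 1)) %/ 2) s.

Definition even_array k (s : k.-tuple bool) : 'M[bool]_(k.+1, k) :=
  (\matrix_(i < k.+1, c < k)
     tnth (triangular_row s (if (i < k)%N then i : nat else k.-1)) c)%R.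

Definition odd_array k (s : k.-tuple bool) : 'M[bool]_(k, k) :=
  (\matrix_(i < k, c < k) tnth (triangular_row s i) c)%R.

(* Main.v *)
Require Import Defs.
From mathcomp Require Import all_boot all_order all_algebra.
From mathcomp Require Import zify.

(** Let the rows of a 2 x n matrix be covered by the windows of [s] at [i] and
    [j]. Rows [r] and [r + 1] of the array are shifts of [s] by triangular
    numbers differing by [r + 1], so taking [r + 1] congruent to [j - i] and
    then aligning the column puts exactly these two windows on top of each
    other. The remaining difference 0 needs row [k - 1] to be followed by a row
    equal to it: for odd [k] the next row is row 0, and [k] divides
    [(k - 1) k / 2]; for even [k] the next row is the repeated one. *)

Lemma mx_dist_row m n (B X : 'M[bool]_(m, n)) :
  mx_dist B X =
  \sum_(a < m) word_dist [tuple B a b | b < n] [tuple X a b | b < n].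
Proof.
rewrite /mx_dist /word_dist -sum1dep_card big_mkcond /=.
rewrite -(pair_bigA _ (fun a b => if B a b != X a b then 1 else 0)) /=.
apply: eq_bigr => a _; rewrite -sum1dep_card [RHS]big_mkcond /=.
by apply: eq_bigr => b _; rewrite !tnth_mktuple.
Qed.

(** Common to both parities: it suffices that shift differences of cyclically consecutive rows
    realize every residue modulo [k]. *)
Lemma shifted_rows_covering M k n R (s : k.-tuple bool) (f : 'I_M -> nat)
    (A : 'M[bool]_(M, k)) :
  covering_seq n R s ->
  (forall r, [tuple A r c | c < k] = cyc_shift (f r) s) ->
  (forall d, 0 < k -> exists r, f (cyc_add r 1) = f r + d %[mod k]) ->
  covering_array 2 n (2 * R) A.
Proof.
move=> hs hA hf B.
have [i hi] := hs [tuple B ord0 b | b < n].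
have [j hj] := hs [tuple B (lift ord0 ord0) b | b < n].
have k0 : 0 < k by apply: leq_ltn_trans (ltn_ord i).
(* This is [j - i] modulo [k], written to avoid truncated subtraction. *)
have [r hr] := hf (j + (k - i)) k0.
have hAE r' c : A r' c = tnth s (cyc_add c (f r')).
  by have := congr1 (fun t => tnth t c) (hA r'); rewrite !tnth_mktuple.
(* The column [i - f r] modulo [k] cancels the shift of row [r]. *)
set c := cyc_add i (k - f r %% k).
have hc : c + f r = i %[mod k].
  have lt_fr : f r %% k < k by rewrite ltn_pmod.
  rewrite /= modnDml -modnDmr -addnA subnK ?modnDr //; exact: ltnW.
have hc' : c + f (cyc_add r 1) = j %[mod k].
  rewrite -modnDmr hr modnDmr addnA -modnDml hc modnDml addnCA subnKC.
    by rewrite modnDr.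
  exact: ltnW.
have windowE (a : 'I_2) (i' : 'I_k) : c + f (cyc_add r a) = i' %[mod k] ->
    [tuple array_window 2 n A r c a b | b < n] = seq_window n s i'.
  move=> e; apply: eq_from_tnth => b; rewrite !tnth_mktuple mxE hAE.
  congr (tnth s _); apply: val_inj.
  by rewrite /= modnDml addnAC -modnDml e modnDml.
have r0 : cyc_add r 0 = r by apply: val_inj; rewrite /= addn0 modn_small.
exists r, c; rewrite mx_dist_row !big_ord_recl big_ord0 addn0 mulSn mul1n.
by rewrite (windowE _ i) ?(windowE _ j) ?leq_add //= r0.
Qed.

Lemma triangularS r :
  (r.+1 * (r.+1 + 1)) %/ 2 = (r * (r + 1)) %/ 2 + r.+1.
Proof.
have -> : r.+1 * (r.+1 + 1) = r.+1 * 2 + r * (r + 1) by lia.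
by rewrite divnMDl // addnC.
Qed.

Lemma exists_ord_succ_mod k d : 0 < k -> exists r : 'I_k, r.+1 = d %[mod k].
Proof.
(* Adding [k.-1] stands for subtracting 1, so [d = 0] gives the last index. *)
move=> k0; exists (Ordinal (ltn_pmod (d + k.-1) k0)) => /=.
by rewrite -addn1 modnDml -addnA addn1 prednK // modnDr.
Qed.

Theorem theorem8 (k n R : nat) (s : k.-tuple bool) (hs : covering_seq n R s) :
  (~~ odd k -> covering_array 2 n (2 * R) (even_array s)) /\
  (odd k -> covering_array 2 n (2 * R) (odd_array s)).
Proof.
split=> [_ | k_odd].
- pose row i := if i < k then i else k.-1.
  pose f (r : 'I_k.+1) := (row r * (row r + 1)) %/ 2.
  apply: (@shifted_rows_covering _ _ _ _ _ f _ hs) => [r | d k0].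
    by apply: eq_from_tnth => c; rewrite tnth_mktuple mxE.
  have [r hr] := exists_ord_succ_mod k d k0.
  exists (widen_ord (leqnSn k) r).
  have rS : cyc_add (widen_ord (leqnSn k) r) 1 = r.+1 :> nat.
    by rewrite /= addn1 modn_small ?ltnS.
  rewrite -modnDmr -hr modnDmr /f /row rS /= ltn_ord.
  have [lt_rk | ge_rk] := ltnP r.+1 k; first by rewrite triangularS.
  (* Row [k] repeats row [r], so the required difference [r.+1 = k] vanishes modulo [k]. *)
  have rk : r.+1 = k by apply/eqP; rewrite eqn_leq ge_rk ltn_ord.
  have -> : k.-1 = r by rewrite -[in LHS]rk.
  by rewrite [in RHS]rk modnDr.
pose f (r : 'I_k) := (r * (r + 1)) %/ 2.
apply: (@shifted_rows_covering _ _ _ _ _ f _ hs) => [r | d k0].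
  by apply: eq_from_tnth => c; rewrite tnth_mktuple mxE.
have [r hr] := exists_ord_succ_mod k d k0; exists r.
have rS : cyc_add r 1 = r.+1 %% k :> nat by rewrite /= addn1.
rewrite -modnDmr -hr modnDmr /f rS.
have [lt_rk | ge_rk] := ltnP r.+1 k.
  by rewrite (modn_small lt_rk) triangularS.
have rk : r.+1 = k by apply/eqP; rewrite eqn_leq ge_rk ltn_ord.
(* The successor wraps to row 0, with shift 0; evenness of [r] turns the last shift into the
   multiple [(r %/ 2) * k]. *)
have r_even : 2 %| r by rewrite dvdn2 -oddS rk.
by rewrite rk modnn mul0n div0n modnDr addn1 rk -divn_mulAC // modnMl mod0n.
Qed.
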